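(* Let $\mathcal A$ be any deterministic streaming algorithm that processes sequences of insert and delete operations on items from a set of $n$ items, using fewer than $n$ bits of storage. Then there exist two operation streams, one consisting of matched pairs (every item is inserted and later deleted exactly once, so the operations pair up as insert $x$/delete $x$) and another whose insert and delete operations cannot be matched in such pairs, after which $\mathcal A$ is in the same state; that is, $\mathcal A$ cannot distinguish a stream of matched insert/delete pairs from one that is not matched in pairs.
   Context: A deterministic streaming algorithm has a fixed initial state and processes a stream of operations (here, ''insert $x$'' and ''delete $x$'' for items $x$ of an $n$-element set) one at a time, each operation deterministically transforming the current state into a new state, the state being stored in its bits of storage. *)

(* Defs.v *)
From HB Require Import structures.
From mathcomp Require Import all_boot.

Set Implicit Arguments.
Unset Strict Implicit.
Unset Printing Implicit Defensive.

Inductive operation (T : Type) : Type :=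
  | Insert of T
  | Delete of T.

Section OperationEqType.
Variable T : eqType.

Definition operation_to_sum (o : operation T) : T + T :=
  match o with Insert x => inl x | Delete x => inr x end.

Definition operation_of_sum (u : T + T) : operation T :=
  match u with inl x => Insert x | inr x => Delete x end.

Lemma operation_to_sumK : cancel operation_to_sum operation_of_sum.
Proof. by case. Qed.

HB.instance Definition _ :=
  Equality.copy (operation T) (can_type operation_to_sumK).

End OperationEqType.

(* The whole memory of the algorithm between two operations is b bits; the
   transition function is arbitrary (no computability or time bound). *)
Record streaming_algorithm (T : Type) (b : nat) : Type := StreamingAlgorithm {
  initial_state : b.-tuple bool;
  transition : b.-tuple bool -> operation T -> b.-tuple bool
}.

Definition state_after (T : Type) (b : nat) (A : streaming_algorithm T b)
    (s : seq (operation T)) : b.-tuple bool :=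
  foldl (transition A) (initial_state A) s.

Definition insert_delete_pair (T : Type) (s : seq (operation T))
    (i j : 'I_(size s)) : Prop :=
  i < j /\
  exists x : T, tnth (in_tuple s) i = Insert x /\ tnth (in_tuple s) j = Delete x.

(* M is a perfect matching of the positions of s. An item may occur in several
   pairs of M, so the negation of this predicate excludes every pairing. *)
Definition matched_in_pairs (T : Type) (s : seq (operation T)) : Prop :=
  exists M : {set 'I_(size s) * 'I_(size s)},
    (forall i j : 'I_(size s), (i, j) \in M -> insert_delete_pair i j) /\
    (forall k : 'I_(size s),
       exists! p : 'I_(size s) * 'I_(size s), p \in M /\ (k = p.1 \/ k = p.2)).

Definition inserted_then_deleted_once (T : eqType) (s : seq (operation T))
    (x : T) : Prop :=
  [/\ count_mem (Insert x) s = 1,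
      count_mem (Delete x) s = 1
    & index (Insert x) s < index (Delete x) s].

(* Main.v *)
Require Import Defs.
From HB Require Import structures.
From mathcomp Require Import all_boot.
From mathcomp Require Import zify.

(** Pigeonhole: there are more subsets of [T] than states, so inserting the items
    of two distinct sets [S] and [S'] leads to the same state. Continue both
    streams by inserting the complement of [S] and then deleting every item.
    The first stream is matched, while in the second one any item of the
    symmetric difference is inserted zero or two times but deleted once. *)

Set Implicit Arguments.
Unset Strict Implicit.
Unset Printing Implicit Defensive.

Lemma Insert_inj (T : Type) : injective (@Insert T).
Proof. by move=> x y []. Qed.

Lemma Delete_inj (T : Type) : injective (@Delete T).
Proof. by move=> x y []. Qed.

Section CountOperations.
Variables (T : eqType) (x : T).
Implicit Type u : seq T.

Lemma count_Insert_map_Insert u :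
  count_mem (Insert x) (map (@Insert T) u) = count_mem x u.
Proof.
by rewrite count_map; apply: eq_count => y /=; rewrite (inj_eq (@Insert_inj T)).
Qed.

Lemma count_Delete_map_Delete u :
  count_mem (Delete x) (map (@Delete T) u) = count_mem x u.
Proof.
by rewrite count_map; apply: eq_count => y /=; rewrite (inj_eq (@Delete_inj T)).
Qed.

Lemma Insert_notin_map_Delete u : Insert x \notin map (@Delete T) u.
Proof. by apply/mapP => -[]. Qed.

Lemma Delete_notin_map_Insert u : Delete x \notin map (@Insert T) u.
Proof. by apply/mapP => -[]. Qed.

Lemma count_Insert_map_Insert_Delete u v :
  count_mem (Insert x) (map (@Insert T) u ++ map (@Delete T) v) = count_mem x u.
Proof.
rewrite count_cat count_Insert_map_Insert.
by rewrite (count_memPn (Insert_notin_map_Delete v)) addn0.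
Qed.

Lemma count_Delete_map_Insert_Delete u v :
  count_mem (Delete x) (map (@Insert T) u ++ map (@Delete T) v) = count_mem x v.
Proof.
rewrite count_cat count_Delete_map_Delete.
by rewrite (count_memPn (Delete_notin_map_Insert u)).
Qed.

Lemma inserted_then_deleted_once_map u :
  uniq u -> x \in u ->
  inserted_then_deleted_once (map (@Insert T) u ++ map (@Delete T) u) x.
Proof.
move=> uu xu; split.
- by rewrite count_Insert_map_Insert_Delete count_uniq_mem ?xu.
- by rewrite count_Delete_map_Insert_Delete count_uniq_mem ?xu.
rewrite !index_cat (negPf (Delete_notin_map_Insert u)) map_f //.
by apply: ltn_addr; rewrite index_mem map_f.
Qed.

End CountOperations.

Lemma count_mem_card_tnth (T : eqType) (s : seq T) (a : T) :
  count_mem a s = #|[set k | tnth (in_tuple s) k == a]|.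
Proof. by rewrite -sum1_count big_tnth sum1dep_card cardsE. Qed.

(** Both projections are injective on a perfect matching, and they map its pairs labelled [x] onto
    the positions of [Insert x] and of [Delete x]. So both counts equal the number of such pairs.
    Unequal counts thus rule out every pairing. *)
Lemma matched_in_pairs_count (T : eqType) (s : seq (operation T)) (x : T) :
  matched_in_pairs s -> count_mem (Insert x) s = count_mem (Delete x) s.
Proof.
case=> M [MP Mu]; rewrite !count_mem_card_tnth.
have M_inj k p q : p \in M -> q \in M -> k = p.1 \/ k = p.2 ->
    k = q.1 \/ k = q.2 -> p = q.
  by move=> pM qM kp kq; have [r [_ ru]] := Mu k; rewrite -(ru p) // -(ru q).
(* Testing the first component suffices: the second one then holds [Delete] of the same item. *)
pose Mx := [set p in M | tnth (in_tuple s) p.1 == Insert x].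
have -> : [set k | tnth (in_tuple s) k == Insert x] = [set p.1 | p in Mx].
  apply/setP => k; rewrite inE; apply/idP/imsetP => [/eqP sk|[p]].
    have [[i j] [[ijM kij] _]] := Mu k.
    have [_ [y [si sj]]] := MP _ _ ijM.
    case: kij => /= kE; last by rewrite kE sj in sk.
    by exists (i, j); rewrite // inE ijM -kE sk eqxx.
  by rewrite inE => /andP[_ ?] ->.
have -> : [set k | tnth (in_tuple s) k == Delete x] = [set p.2 | p in Mx].
  apply/setP => k; rewrite inE; apply/idP/imsetP => [/eqP sk|[[i j]]].
    have [[i j] [[ijM kij] _]] := Mu k.
    have [_ [y [si sj]]] := MP _ _ ijM.
    case: kij => /= kE; first by rewrite kE si in sk.
    move: sj; rewrite -kE sk => -[xy].
    by exists (i, j); rewrite // inE ijM /= si -xy eqxx.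
  rewrite inE /= => /andP[ijM /eqP six] ->.
  by have [_ [y [si ->]]] := MP _ _ ijM; move: si; rewrite six => -[->].
rewrite !card_in_imset // => p q; rewrite !inE => /andP[pM _] /andP[qM _] pq.
  by apply: (M_inj p.2) => //; right.
by apply: (M_inj p.1) => //; left.
Qed.

(** Both halves list [u] in the same order, so a shift by [size u] matches them, even if [u] has
    repetitions. *)
Lemma matched_in_pairs_map_Insert_Delete (T : Type) (u : seq T) :
  matched_in_pairs (map (@Insert T) u ++ map (@Delete T) u).
Proof.
set s := _ ++ _.
have ss : size s = size u + size u by rewrite size_cat !size_map.
exists [set p : 'I_(size s) * 'I_(size s) | p.2 == p.1 + size u :> nat].
split=> [i j|k].
  rewrite inE /= => /eqP ji.
  have iu : i < size u by have := ltn_ord j; rewrite [X in _ < X]ss ji ltn_add2r.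
  split; first by lia.
  (* [T] has no default element, so the item at [i] is obtained by [tnth] and then serves as the
     default for [nth]. *)
  pose x := tnth (in_tuple u) (Ordinal iu).
  exists x; rewrite !(tnth_nth (Insert x)) /= ji !nth_cat !size_map iu.
  rewrite ltnNge leq_addl /= addnK !(nth_map x) // -[nat_of_ord i]/(val (Ordinal iu)).
  by rewrite -[u in nth x u]/(val (in_tuple u)) -tnth_nth.
have ks : k < size u + size u by rewrite -ss.
(* The half containing [k] decides its role: first components lie below [size u], second ones do
   not. *)
case: (ltnP k (size u)) => ku.
  have k's : k + size u < size s by lia.
  exists (k, Ordinal k's); split; first by rewrite inE /= eqxx; split; [|left].
  case=> i j; rewrite inE /= => -[/eqP ji kE].
  case: kE => kE; last by subst k; lia.
  by subst k; congr pair; apply: val_inj; rewrite /= ji.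
have k's : k - size u < size s by lia.
exists (Ordinal k's, k); split; first by rewrite inE /= subnK ?eqxx //; split; [|right].
case=> i j; rewrite inE /= => -[/eqP ji kE].
case: kE => kE; first by subst k; have := ltn_ord j; rewrite [X in _ < X]ss; lia.
by subst k; congr pair; apply: val_inj; rewrite /= ji addnK.
Qed.

Lemma state_after_cat (T : Type) (b : nat) (A : streaming_algorithm T b)
    (s1 s2 s : seq (operation T)) :
  state_after A s1 = state_after A s2 ->
  state_after A (s1 ++ s) = state_after A (s2 ++ s).
Proof. by rewrite /state_after !foldl_cat => ->. Qed.

Lemma pigeonhole_sets (T R : finType) (f : {set T} -> R) :
  #|R| < 2 ^ #|T| -> exists S S' : {set T}, S != S' /\ f S = f S'.
Proof.
move=> ltRT; have /injectivePn[S [S' neSS' eqf]] : ~~ injectiveb f.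
  apply/injectiveP => /leq_card.
  (* The type [{set T}] is counted as the power set of the full set. *)
  by rewrite -[X in X <= _]cardsT -powersetT card_powerset cardsT leqNgt ltRT.
by exists S, S'.
Qed.

Theorem theorem3 (T : finType) (n b : nat) (hT : #|T| = n) (hb : b < n)
    (A : streaming_algorithm T b) :
  exists s1 s2 : seq (operation T),
    [/\ matched_in_pairs s1,
        forall x : T, inserted_then_deleted_once s1 x,
        ~ matched_in_pairs s2
      & state_after A s1 = state_after A s2].
Proof.
have [|S [S' [neSS' eqA]]] :=
    @pigeonhole_sets T _ (fun S => state_after A (map (@Insert T) (enum S))).
  by rewrite card_tuple card_bool hT ltn_exp2l.
(* The complement is that of [S] for every [X], so the two streams differ only in their first block
   of insertions. *)
pose u (X : {set T}) := enum X ++ enum (~: S).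
pose D := map (@Delete T) (u S).
have uE x X : count_mem x (u X) = (x \in X) + (x \notin S).
  by rewrite count_cat !count_uniq_mem ?enum_uniq // !mem_enum inE.
have uniq_u : uniq (u S).
  rewrite cat_uniq !enum_uniq andbT /=; apply/hasPn => x.
  by rewrite !mem_enum inE.
exists (map (@Insert T) (u S) ++ D), (map (@Insert T) (u S') ++ D); split.
- exact: matched_in_pairs_map_Insert_Delete.
- move=> x; apply: inserted_then_deleted_once_map => //.
  by rewrite mem_cat !mem_enum inE orbN.
- move=> m2; case/eqP: neSS'; apply/setP => x.
  (* Each item is deleted once. Cancelling the common term [x \notin S] from both counts leaves
     equal membership of [x] in [S'] and [S]. *)
  have := matched_in_pairs_count x m2.
  rewrite count_Insert_map_Insert_Delete count_Delete_map_Insert_Delete !uE.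
  by move/addIn; do 2!case: (x \in _).
(* Reassociating exposes the common suffix after the insertions of [S] and [S']. *)
by rewrite !map_cat -!catA; apply: state_after_cat.
Qed.
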